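(* For all integers $n,k$ (with $k$ possibly depending on $n$) and every real $p\in[0,1]$, if $\mathbf{G}\sim\mathcal{G}(n,p,k)$, then asymptotically almost surely every semantic cutting planes refutation of $\mathrm{BinClique}^{\mathrm{block}}(\mathbf{G},k)$ has length at least $$\exp\left(\Omega\left(\min\left(\frac{1}{\sqrt{1-p}},\ \frac{n^{1/4}}{\log(kn)}\right)\right)\right).$$
   Context: Graphs are over $k$ blocks $V_1\sqcup\dots\sqcup V_k$ with $|V_i|=n$, $n$ a power of $2$; each vertex of $V_i$ is identified with its binary representation $\mathsf{bin}(v)=v_1\dots v_{\log n}\in\{0,1\}^{\log n}$. $\mathcal{G}(n,p,k)$: each pair of vertices in different blocks is an edge independently with probability $p$, no edges within blocks. For a Boolean variable $x$, $(x\neq 0)$ denotes the literal $x$ and $(x\neq 1)$ denotes $\overline{x}$. The CNF $\mathrm{BinClique}^{\mathrm{block}}(G,k)$ has variables $x_{i,a}$ for $i\in[k]$, $a\in[\log n]$, and for every $i\neq j$, every $v_i\in V_i$, $v_j\in V_j$ with $\{v_i,v_j\}\notin E(G)$ the clause $\bigvee_{a=1}^{\log n}(x_{i,a}\neq v_{i,a})\vee\bigvee_{a=1}^{\log n}(x_{j,a}\neq v_{j,a})$ (asserting that $v_i,v_j$ are not both chosen as the clique members of blocks $i,j$). A CNF is translated into linear inequalities by adding $0\le x\le 1$ for each variable and $\sum_{i\in I}x_i+\sum_{j\in J}(1-x_j)\ge 1$ for each clause $\bigvee_{i\in I}x_i\vee\bigvee_{j\in J}\overline{x_j}$. A semantic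 cutting planes refutation of a system $Ax\ge b$ is a sequence of linear inequalities $d_\ell x\ge c_\ell$ ($d_\ell\in\mathbb{R}^n$, $c_\ell\in\mathbb{R}$), $\ell\in[L]$, ending with $0\ge 1$, where each inequality is either in the system or is implied over $\{0,1\}^n$ by two earlier inequalities (every $x\in\{0,1\}^n$ satisfying both satisfies it); its length is $L$. ''Asymptotically almost surely'' means with probability $1-o(1)$ as $n\to\infty$. *)

(* Defs.v *)
From HB Require Import structures.
From mathcomp Require Import all_boot all_order all_algebra.
From mathcomp Require Import boolp reals sequences exp.
Set Implicit Arguments. Unset Strict Implicit. Unset Printing Implicit Defensive.
Import Order.TTheory GRing.Theory Num.Theory.
Local Open Scope ring_scope.

(* Throughout, n = 2^m (so log n = m), k blocks. *)

(* Vertices: block i : 'I_k and index v : 'I_(2^m) inside V_i. *)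
Definition vert (m k : nat) : finType := ('I_k * 'I_(2 ^ m))%type.

(* The a-th bit (a = 0 .. m-1, i.e. v_{a+1}) of bin(v) = v_1 ... v_m,
   most significant bit first. *)
Definition vbit (m : nat) (v : nat) (a : 'I_m) : bool :=
  odd (v %/ 2 ^ (m.-1 - a)).

Definition cross_pairs (m k : nat) : {set {set vert m k}} :=
  [set e : {set vert m k} |
     [exists u : vert m k, exists w : vert m k,
        (u.1 != w.1) && (e == [set u; w])]].

Definition is_graph (m k : nat) (G : {set {set vert m k}}) : bool :=
  G \subset cross_pairs m k.

(* Probability of an event A under G(n,p,k): each cross pair is an edge
   independently with probability p. *)
Definition Pr_G (R : realType) (m k : nat) (p : R)
    (A : {set {set {set vert m k}}}) : R :=
  \sum_(G in A | is_graph G)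
     p ^+ #|G| * (1 - p) ^+ (#|cross_pairs m k| - #|G|).

Definition var (m k : nat) : finType := ('I_k * 'I_m)%type.

(* A literal (x, true) is x, (x, false) is the negation of x. *)
Definition literal (X : finType) := (X * bool)%type.
Definition clause (X : finType) := seq (literal X).

Definition lit_neq (X : finType) (x : X) (b : bool) : literal X := (x, ~~ b).

Definition bc_clause (m k : nat) (i j : 'I_k) (vi vj : 'I_(2 ^ m)) : clause (var m k) :=
  [seq lit_neq (i, a) (vbit vi a) | a <- enum 'I_m] ++
  [seq lit_neq (j, a) (vbit vj a) | a <- enum 'I_m].

Definition in_BinClique (m k : nat) (G : {set {set vert m k}}) (C : clause (var m k)) : Prop :=
  exists (i j : 'I_k) (vi vj : 'I_(2 ^ m)),
    i != j /\ [set (i, vi); (j, vj)] \notin G /\ C = @bc_clause m k i j vi vj.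

(* Linear inequalities  d . x >= c  over the variables X. *)
Definition ineq (R : realType) (X : finType) := ({ffun X -> R} * R)%type.

Definition holds01 (R : realType) (X : finType) (l : ineq R X) (x : {ffun X -> bool}) : bool :=
  l.2 <= \sum_(y : X) l.1 y * (x y)%:R.

Definition lower_ineq (R : realType) (X : finType) (x : X) : ineq R X :=
  ([ffun y => (y == x)%:R], 0).
Definition upper_ineq (R : realType) (X : finType) (x : X) : ineq R X :=
  ([ffun y => - (y == x)%:R], -1).

(* Translation of a clause  OR_{i in I} x_i  OR  OR_{j in J} ~x_j  into
   sum_{i in I} x_i + sum_{j in J} (1 - x_j) >= 1, i.e.
   sum_I x_i - sum_J x_j >= 1 - |J|. *)
Definition clause_ineq (R : realType) (X : finType) (C : clause X) : ineq R X :=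
  ([ffun y => \sum_(l <- C | l.1 == y) (if l.2 then 1 else -1)],
   1 - (count (fun l : literal X => ~~ l.2) C)%:R).

Definition BinClique_system (R : realType) (m k : nat) (G : {set {set vert m k}})
    (l : ineq R (var m k)) : Prop :=
  (exists x, l = lower_ineq R x) \/ (exists x, l = upper_ineq R x) \/
  (exists C, in_BinClique G C /\ l = clause_ineq R C).

Definition false_ineq (R : realType) (X : finType) : ineq R X := ([ffun => 0], 1).

Definition implies01 (R : realType) (X : finType) (l1 l2 l : ineq R X) : Prop :=
  forall x : {ffun X -> bool}, holds01 l1 x -> holds01 l2 x -> holds01 l x.

Definition semCP_refutation (R : realType) (X : finType) (S : ineq R X -> Prop)
    (s : seq (ineq R X)) : Prop :=
  (0 < size s)%N /\
  last (false_ineq R X) s = false_ineq R X /\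
  forall l : nat, (l < size s)%N ->
    let d0 := false_ineq R X in
    S (nth d0 s l) \/
    exists l1 l2 : nat, [/\ (l1 < l)%N, (l2 < l)%N &
      implies01 (nth d0 s l1) (nth d0 s l2) (nth d0 s l)].

Definition cp_rate (R : realType) (m k : nat) (p : R) : R :=
  Num.min (1 / Num.sqrt (1 - p))
          (Num.sqrt (Num.sqrt (2 ^ m)%:R) / ln ((k * 2 ^ m)%:R)).

(* Main.v *)
Require Import Defs.
From HB Require Import structures.
From mathcomp Require Import all_boot all_order all_algebra.
From mathcomp Require Import boolp reals sequences exp.
From mathcomp Require Import zify ring lra.
Import Order.TTheory GRing.Theory Num.Theory.
Set Implicit Arguments. Unset Strict Implicit. Unset Printing Implicit Defensive.

(* Cut every vertex name into a high half, given to Alice, and a low half, given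
   to Bob.  The assignments falsifying a linear inequality form a triangle
   {(x, y) | f x < g y}, and a refutation of length L is a sequence of L
   triangles, ending with the full one, each covered by two earlier ones or
   contained in the set falsifying one clause, i.e. selecting one non-edge.

   Inductively every triangle gets, for all but a few y, a set K y of fewer than
   w blocks such that each good (x, y) in the triangle selects a non-edge inside
   K y.  Covering by two triangles doubles the certificates; they are compressed
   back by letting x greedily answer all certificates it must meet, which reads
   at least w blocks of x with probability at most 2^-w, and then letting y
   answer the resulting certificates of x in the same way.  For the full
   triangle a single K y would catch a constant fraction of all x, which is
   impossible, so L >= 2^(w-1).

   The compression needs that a vertex has, in every other block, at most a
   1/(16 w^2) fraction of non-neighbours among the vertices with a prescribed
   half.  By Chernoff's bound this holds almost surely for w of the order of
   min(1/sqrt(1-p), n^(1/4)/log(kn)). *)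

(** * Greedy certificates *)

Lemma leq_card_bigcup (T J : finType) (P : pred J) (F : J -> {set T}) :
  #|\bigcup_(j | P j) F j| <= \sum_(j | P j) #|F j|.
Proof.
elim/big_ind2: _ => // [|A m B n leAm leBn]; first by rewrite cards0.
by rewrite cardsU (leq_trans (leq_subr _ _)) // leq_add.
Qed.

Section Greedy.

Variables (I A B : finType) (ne : I -> A -> B -> I -> A -> B -> bool).

Local Notation X := {ffun I -> A}.
Local Notation Y := {ffun I -> B}.

(** The relation [ne i a b j a' b'] stands for a non-edge between the vertex of block [i] with
    halves [a], [b] and that of block [j] with halves [a'], [b']. Left abstract, it can be
    transposed to exchange the players. *)
Definition conflict (x : X) (y : Y) (e : I * I) : bool :=
  (e.1 != e.2) && ne e.1 (x e.1) (y e.1) e.2 (x e.2) (y e.2).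

Definition hit (K : {set I}) (x : X) (y : Y) : bool :=
  [exists e : I * I, [&& e.1 \in K, e.2 \in K & conflict x y e]].

Lemma hit_sub (K L : {set I}) x y : K \subset L -> hit K x y -> hit L x y.
Proof.
move=> sKL /existsP[e /and3P[e1 e2 ce]]; apply/existsP; exists e.
by rewrite !(subsetP sKL) //.
Qed.

Definition agree (S : {set I}) (x x0 : X) : bool :=
  [forall i, (i \in S) ==> (x i == x0 i)].

Lemma agreeP (S : {set I}) (x x0 : X) :
  reflect (forall i, i \in S -> x i = x0 i) (agree S x x0).
Proof.
apply: (iffP forallP) => [h i iS|h i]; first by have := h i; rewrite iS => /eqP.
by apply/implyP => iS; rewrite h.
Qed.

Lemma card_agree (S : {set I}) (x0 : X) :
  #|[set x | agree S x x0]| = #|A| ^ #|~: S|.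
Proof.
pose F i : pred A := fun a => (i \in S) ==> (a == x0 i).
have -> : #|[set x | agree S x x0]| = #|(family F : simpl_pred X)|.
  by apply: eq_card => x; rewrite inE; apply: eq_forallb => i.
rewrite card_family foldrE big_map big_enum /=.
rewrite (bigID (mem S)) /= big1 ?mul1n => [|i iS]; last first.
  by rewrite -(card1 (x0 i)); apply: eq_card => a; rewrite !inE /F iS.
rewrite -prod_nat_const; apply: eq_big => [i|i iS]; first by rewrite inE.
by apply: eq_card => a; rewrite !inE /F (negbTE iS).
Qed.

(* The queries [ls] are answered in order and [S] is the part of [x] read so
   far; a query certified by [S] costs nothing, and the first failing query
   ends the process. *)
Fixpoint run (T : X -> Y -> bool) (J : Y -> {set I}) (x : X) (S : {set I})
    (ls : seq Y) : {set I} :=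
  if ls is y :: ls' then
    if ~~ T x y then S else
    if hit (S :&: J y) x y then run T J x S ls' else
    if [pick e : I * I | [&& e.1 \in J y, e.2 \in J y & conflict x y e]] is Some e
    then run T J x (e.1 |: (e.2 |: S)) ls' else S
  else S.

Lemma run_sub T J x ls (S : {set I}) : S \subset run T J x S ls.
Proof.
elim: ls S => //= y ls IH S; case: ifP => // _; case: ifP => // _.
case: pickP => // e _; apply: subset_trans (IH _).
by rewrite setUA subsetUr.
Qed.

(** By the pairwise hypothesis, all queries before one that [x] meets are met too, so the process
    does not stop earlier; at that query a conflict is either already read or gets read. *)
Lemma run_hit (T : X -> Y -> bool) J x ls (S : {set I}) :
  {in ls, forall y, T x y -> hit (J y) x y} ->
  pairwise (fun y y' => T x y' ==> T x y) ls ->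
  {in ls, forall y, T x y -> hit (run T J x S ls :&: J y) x y}.
Proof.
elim: ls S => //= y0 ls IH S hls /andP[/allP hp0 hp] y.
have hls' : {in ls, forall y, T x y -> hit (J y) x y}.
  by move=> z zls; apply: hls; rewrite inE zls orbT.
rewrite inE => /orP[/eqP->|yls] Txy.
  rewrite Txy /=; case: ifP => h.
    by apply: hit_sub h; rewrite setSI // run_sub.
  case: pickP => [e /and3P[e1 e2 ce]|no].
    apply/existsP; exists e; rewrite ce !inE e1 e2 !andbT.
    by rewrite !(subsetP (run_sub _ _ _ _ _)) // !inE eqxx ?orbT.
  have /existsP[e] := hls y0 (mem_head _ _) Txy.
  by rewrite no.
have := hp0 _ yls; rewrite Txy /= => Ty0; rewrite Ty0 /=.
case: ifP => _; first exact: IH.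
case: pickP => [e _|no]; first exact: IH.
have /existsP[e] := hls y0 (mem_head _ _) Ty0.
by rewrite no.
Qed.

Hypothesis ne_sym : forall i a b j a' b', ne i a b j a' b' = ne j a' b' i a b.

Variable D : nat.
Hypothesis D_gt0 : 0 < D.
Hypothesis sparse : forall i j a b b', i != j ->
  D * #|[set a' | ne i a b j a' b']| <= #|A|.

Definition consistent (S : {set I}) (x0 : X) (y : Y) (e : I * I) (p : A * A) :=
  [&& ne e.1 p.1 (y e.1) e.2 p.2 (y e.2), (e.1 \in S) ==> (p.1 == x0 e.1) &
      (e.2 \in S) ==> (p.2 == x0 e.2)].

Definition upd (x0 : X) (e : I * I) (p : A * A) : X :=
  [ffun i => if i == e.1 then p.1 else if i == e.2 then p.2 else x0 i].

(** Reading [e] gains a factor [D]. With one block already read, [sparse] bounds the values at the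
    other; with neither read, this bound is summed over the value at one block; with both read, no
    pair is consistent. *)
Lemma card_consistent (S : {set I}) x0 y e : e.1 != e.2 ->
  ~~ [&& e.1 \in S, e.2 \in S & conflict x0 y e] ->
  D * #|[set p | consistent S x0 y e p]| * #|A| ^ #|~: (e.1 |: (e.2 |: S))|
    <= #|A| ^ #|~: S|.
Proof.
case: e => i j /= ij nh.
have cC (K : {set I}) l : l \notin K -> #|~: K| = #|~: (l |: K)|.+1.
  by move=> lK; rewrite setCU setIC -setDE (cardsD1 l (~: K)) inE lK.
have bound1 a : D * #|[set p | consistent S x0 y (i, j) p & p.1 == a]| <= #|A|.
  apply: leq_trans (sparse a (y i) (y j) ij); rewrite leq_mul2l; apply/orP; right.
  have -> : #|[set p | consistent S x0 y (i, j) p & p.1 == a]|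
     = #|[set p.2 | p in [set p | consistent S x0 y (i, j) p & p.1 == a]]|.
    rewrite card_in_imset // => -[p1 p2] [q1 q2]; rewrite !inE /=.
    by move=> /andP[_ /eqP->] /andP[_ /eqP->] ->.
  apply/subset_leq_card/subsetP => z /imsetP[[p1 p2]]; rewrite !inE /=.
  by case/andP => /and3P[/= h _ _] /eqP <- ->.
have bound2 a : D * #|[set p | consistent S x0 y (i, j) p & p.2 == a]| <= #|A|.
  have ji : j != i by rewrite eq_sym.
  apply: leq_trans (sparse a (y j) (y i) ji); rewrite leq_mul2l; apply/orP; right.
  have -> : #|[set p | consistent S x0 y (i, j) p & p.2 == a]|
     = #|[set p.1 | p in [set p | consistent S x0 y (i, j) p & p.2 == a]]|.
    rewrite card_in_imset // => -[p1 p2] [q1 q2]; rewrite !inE /=.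
    by move=> /andP[_ /eqP->] /andP[_ /eqP->] ->.
  apply/subset_leq_card/subsetP => z /imsetP[[p1 p2]]; rewrite !inE /=.
  by case/andP => /and3P[/= h _ _] /eqP <- ->; rewrite ne_sym.
have [iS|iS] := boolP (i \in S); have [jS|jS] := boolP (j \in S).
- rewrite [X in _ * X * _](_ : _ = 0) ?muln0 ?mul0n //.
  apply/eqP; rewrite cards_eq0; apply/eqP/setP => -[p1 p2]; rewrite !inE.
  apply: contraNF nh => /and3P[/= h]; rewrite iS jS /= => /eqP e1 /eqP e2.
  by rewrite /conflict /= ij -e1 -e2.
- have -> : i |: (j |: S) = j |: S.
    by apply/setUidPr; rewrite sub1set !inE iS orbT.
  rewrite (cC _ _ jS) expnS leq_mul2r; apply/orP; right.
  apply: leq_trans (bound1 (x0 i)); rewrite leq_mul2l; apply/orP; right.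
  apply/subset_leq_card/subsetP => p; rewrite !inE => cp; rewrite cp /=.
  by case/and3P: cp => _ /=; rewrite iS.
- have -> : i |: (j |: S) = i |: S.
    by congr (_ |: _); apply/setUidPr; rewrite sub1set.
  rewrite (cC _ _ iS) expnS leq_mul2r; apply/orP; right.
  apply: leq_trans (bound2 (x0 j)); rewrite leq_mul2l; apply/orP; right.
  apply/subset_leq_card/subsetP => p; rewrite !inE => cp; rewrite cp /=.
  by case/and3P: cp => _ _ /=; rewrite jS.
rewrite (cC _ _ jS) (cC (j |: S) i) ?inE ?negb_or ?ij // !expnS mulnA leq_mul2r.
apply/orP; right.
have -> : [set p | consistent S x0 y (i, j) p]
   = \bigcup_(a : A) [set p | consistent S x0 y (i, j) p & p.1 == a].
  apply/setP => p; rewrite inE; apply/idP/bigcupP => [cp|[a _]].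
    by exists p.1; rewrite // inE cp /=.
  by rewrite inE => /andP[].
apply: (@leq_trans (D * \sum_(a : A) #|[set p | consistent S x0 y (i, j) p & p.1 == a]|)).
  by rewrite leq_mul2l leq_card_bigcup orbT.
rewrite big_distrr /= -sum_nat_const; exact: leq_sum.
Qed.

Variables (T : X -> Y -> bool) (J : Y -> {set I}).

(** Induction on the queries, conditioning on the part [S] read. An uncertified query offers at most
    [#|J y| ^ 2] pairs; each adds at most two blocks, a factor 4 in [2 ^ #|S|], and costs a factor
    [D] in probability, so [4 * #|J y| ^ 2 <= D] preserves the bound. *)
Lemma run_card (w : nat) ls (S : {set I}) x0 :
  {in ls, forall y, 4 * #|J y| ^ 2 <= D} ->
  2 ^ w * #|[set x | agree S x x0 & w <= #|run T J x S ls|]|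
    <= 2 ^ #|S| * #|A| ^ #|~: S|.
Proof.
elim: ls S x0 => [|y ls IH] S x0 hJ;
  (have [wS|Sw] := leqP w #|S|;
   [by apply: leq_mul; [rewrite leq_exp2l|rewrite -(card_agree S x0);
    apply/subset_leq_card/subsetP => x; rewrite !inE => /andP[]]|]).
  rewrite [X in _ * X](_ : _ = 0) ?muln0 //.
  apply/eqP; rewrite cards_eq0; apply/eqP/setP => x; rewrite !inE /=.
  by rewrite andbF.
have hJ' : {in ls, forall y, 4 * #|J y| ^ 2 <= D}.
  by move=> z zls; apply: hJ; rewrite inE zls orbT.
have hitE x : agree S x x0 -> hit (S :&: J y) x y = hit (S :&: J y) x0 y.
  move=> /agreeP ag; apply: eq_existsb => e; rewrite !inE.
  have [e1S|] := boolP (e.1 \in S) => //=; have [e2S|] := boolP (e.2 \in S); rewrite ?andbF //.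
  by rewrite /conflict !ag.
have [h0|h0] := boolP (hit (S :&: J y) x0 y).
  apply: leq_trans (IH S x0 hJ'); rewrite leq_mul2l; apply/orP; right.
  apply/subset_leq_card/subsetP => x; rewrite !inE /= => /andP[ag].
  rewrite ag hitE // h0; case: ifP => // _.
  by rewrite leqNgt Sw.
pose P (e : I * I) := [&& e.1 \in J y, e.2 \in J y & e.1 != e.2].
pose S' (e : I * I) := e.1 |: (e.2 |: S).
pose F e := [set x | agree S x x0 && consistent S x0 y e (x e.1, x e.2)
   & w <= #|run T J x (S' e) ls|].
have sub : [set x | agree S x x0 & w <= #|run T J x S (y :: ls)|]
    \subset \bigcup_(e | P e) F e.
  apply/subsetP => x; rewrite !inE /= => /andP[ag].
  rewrite hitE // (negbTE h0); case: ifP => _; first by rewrite leqNgt Sw.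
  case: pickP => [e /and3P[e1 e2 /andP[ne12 ce]] hw|_]; last by rewrite leqNgt Sw.
  apply/bigcupP; exists e; first by rewrite /P e1 e2.
  rewrite inE ag hw andbT /= /consistent ce /=.
  by apply/andP; split; apply/implyP => eS; rewrite (agreeP _ _ _ ag).
have Fbound e : P e -> D * (2 ^ w * #|F e|) <= 4 * (2 ^ #|S| * #|A| ^ #|~: S|).
  case/and3P=> e1 e2 ne12.
  (* Split further by the values read at [e]; [upd] records them in the reference point, so that the
     induction hypothesis applies to each part. *)
  have sF : F e \subset \bigcup_(p | consistent S x0 y e p)
      [set x | agree (S' e) x (upd x0 e p) & w <= #|run T J x (S' e) ls|].
    apply/subsetP => x; rewrite inE => /andP[/andP[ag cs] hw].
    apply/bigcupP; exists (x e.1, x e.2); rewrite // inE hw andbT.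
    apply/agreeP => i; rewrite ffunE !inE /=.
    by have [->|] := eqVneq i e.1 => //=; have [->|] := eqVneq i e.2 => //= _ _; apply/agreeP.
  have nh : ~~ [&& e.1 \in S, e.2 \in S & conflict x0 y e].
    apply: contraNN h0 => /and3P[e1S e2S ce]; apply/existsP; exists e.
    by rewrite !inE e1S e2S e1 e2.
  have cS' : #|S' e| <= 2 + #|S|.
    by rewrite /S' !cardsU1 addnA leq_add2r -[2]/(1 + 1) leq_add ?leq_b1.
  apply: (@leq_trans (D * \sum_(p | consistent S x0 y e p) (2 ^ #|S' e| * #|A| ^ #|~: S' e|))).
    rewrite leq_mul2l; apply/orP; right.
    apply: leq_trans (_ : 2 ^ w * \sum_(p | consistent S x0 y e p)
      #|[set x | agree (S' e) x (upd x0 e p) & w <= #|run T J x (S' e) ls|]| <= _).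
      rewrite leq_mul2l; apply/orP; right.
      exact: leq_trans (subset_leq_card sF) (leq_card_bigcup _ _).
    by rewrite big_distrr /=; apply: leq_sum => p _; apply: IH.
  rewrite sum_nat_const.
  have -> : #|[pred p | consistent S x0 y e p]| = #|[set p | consistent S x0 y e p]|.
    by apply: eq_card => p; rewrite !inE.
  have := card_consistent ne12 nh; rewrite -/(S' e) => hc.
  have h2 : 2 ^ #|S' e| <= 4 * 2 ^ #|S|.
    by rewrite -[4]/(2 ^ 2) -expnD leq_exp2l.
  rewrite [4 * _]mulnA; apply: leq_trans (leq_mul h2 hc).
  by apply: eq_leq; ring.
have sz : 4 * #|[pred e | P e]| <= D.
  apply: leq_trans (hJ y (mem_head _ _)); rewrite leq_mul2l /= -mulnn -cardsX.
  by apply/subset_leq_card/subsetP => -[e1 e2]; rewrite !inE /P => /and3P[/= -> ->].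
have : D * (2 ^ w * #|[set x | agree S x x0 & w <= #|run T J x S (y :: ls)|]|)
   <= D * (2 ^ #|S| * #|A| ^ #|~: S|).
  apply: (@leq_trans (\sum_(e | P e) D * (2 ^ w * #|F e|))).
    rewrite -!big_distrr /= !leq_mul2l; apply/orP; right; apply/orP; right.
    exact: leq_trans (subset_leq_card sub) (leq_card_bigcup _ _).
  apply: leq_trans (_ : \sum_(e | P e) 4 * (2 ^ #|S| * #|A| ^ #|~: S|) <= _).
    exact: leq_sum.
  by rewrite sum_nat_const mulnA leq_mul2r [_ * 4]mulnC sz orbT.
by rewrite leq_mul2l (gtn_eqF D_gt0).
Qed.

End Greedy.

(** * Compression in triangle dags *)

Section Triangle.

Variables (d : Order.disp_t) (V : orderType d) (I A B : finType).
Variable ne : I -> A -> B -> I -> A -> B -> bool.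
Hypothesis ne_sym : forall i a b j a' b', ne i a b j a' b' = ne j a' b' i a b.
Variable D : nat.
Hypothesis D_gt0 : 0 < D.
Hypothesis sparse : forall i j a b b', i != j ->
  D * #|[set a' | ne i a b j a' b']| <= #|A|.

Local Notation X := {ffun I -> A}.
Local Notation Y := {ffun I -> B}.

(* Rows of a triangle are nested, so along the order of decreasing [g] the
   certificates [x] has to meet form a prefix of one sequence common to all
   [x]: this is what allows a single run to serve every threshold at once. *)
Lemma triangle_step (w : nat) (f : X -> V) (g : Y -> V) (XA : {set X}) (YB : {set Y})
    (J : Y -> {set I}) :
  {in YB, forall y, 4 * #|J y| ^ 2 <= D} ->
  {in XA & YB, forall x y, (f x < g y)%O -> hit ne (J y) x y} ->
  exists K : X -> {set I},
    2 ^ w * #|[set x | w <= #|K x|]| <= #|A| ^ #|I| /\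
    {in XA & YB, forall x y, (f x < g y)%O -> hit ne (K x :&: J y) x y}.
Proof.
move=> hJ hh.
pose geg (y y' : Y) := (g y' <= g y)%O.
pose ls := sort geg (enum YB).
have memls y : (y \in ls) = (y \in YB) by rewrite mem_sort mem_enum.
have geg_tr : transitive geg by move=> y x z h1 h2; apply: le_trans h2 h1.
have lss : sorted geg ls by apply: sort_sorted => y y'; apply: le_total.
exists (fun x => run ne (fun x y => (f x < g y)%O) J x set0 ls); split.
  (* [run_card] needs a reference point; without one there is no [x] to count. *)
  case: (pickP X) => [x0 _|noX]; last first.
    by rewrite [X in _ * X]eq_card0 ?muln0 // => x; have := noX x.
  have := @run_card _ _ _ ne ne_sym D D_gt0 sparse (fun x y => (f x < g y)%O) J w ls set0 x0.
  rewrite cards0 mul1n setC0 cardsT => h; apply: leq_trans (h _); last first.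
    by move=> y; rewrite memls; apply: hJ.
  rewrite leq_mul2l; apply/orP; right; apply/subset_leq_card/subsetP => x.
  by rewrite !inE => ->; rewrite andbT; apply/agreeP => i; rewrite inE.
move=> x y xA yB Txy; apply: run_hit; rewrite ?memls //.
  by move=> z; rewrite memls; apply: hh.
rewrite (sorted_pairwise geg_tr) in lss; apply: sub_pairwise lss => y1 y2 h.
by apply/implyP => h2; apply: lt_le_trans h2 h.
Qed.

End Triangle.

Section Dag.

Variables (I A B : finType) (ne : I -> A -> B -> I -> A -> B -> bool).
Hypothesis ne_sym : forall i a b j a' b', ne i a b j a' b' = ne j a' b' i a b.

Local Notation X := {ffun I -> A}.
Local Notation Y := {ffun I -> B}.

(** Apply [triangle_step] with threshold 2 to the single column [y]: a conflict involves two
    distinct blocks, so every [x] that is hit has at least two blocks in [K x]. *)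
Lemma hit_rare D (J : {set I}) (y : Y) : 0 < D ->
  (forall i j a b b', i != j -> D * #|[set a' | ne i a b j a' b']| <= #|A|) ->
  4 * #|J| ^ 2 <= D ->
  4 * #|[set x : X | hit ne J x y]| <= #|A| ^ #|I|.
Proof.
move=> D0 sparse hJ.
have [||K [hK1 hK2]] := @triangle_step _ nat I A B ne ne_sym D D0 sparse 2
   (fun x : X => nat_of_bool (~~ hit ne J x y)) (fun _ => 1) setT [set y] (fun _ => J).
- by [].
- by move=> x z _; rewrite inE => /eqP ->; case: hit.
apply: leq_trans hK1; rewrite leq_mul2l; apply/subset_leq_card/subsetP => x.
rewrite !inE => hx.
have /existsP[e /and3P[]] : hit ne (K x :&: J) x y.
  by apply: hK2; rewrite ?inE // hx.
rewrite !inE => /andP[e1 _] /andP[e2 _] /andP[ne12 _].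
have -> : 2 = #|[set e.1; e.2]| by rewrite cards2 ne12.
by apply/subset_leq_card/subsetP => i; rewrite !inE => /orP[]/eqP->.
Qed.

Variable w : nat.
Hypothesis w_gt2 : 2 < w.
Hypothesis sparseA : forall i j a b b', i != j ->
  16 * w ^ 2 * #|[set a' | ne i a b j a' b']| <= #|A|.
Hypothesis sparseB : forall i j a b a', i != j ->
  16 * w ^ 2 * #|[set b' | ne i a b j a' b']| <= #|B|.

Variables (R : realDomainType) (f : nat -> X -> R) (g : nat -> Y -> R).
Local Notation T l x y := (f l x < g l y)%R.

(** Two runs, first on [x] against the certificates of the [y], then on [y] against those of the
    [x]. The constant in [16 * w ^ 2] is 4 times the square of the doubled size [w.*2]. *)
Lemma compress (l : nat) (XA : {set X}) (YB : {set Y}) (J : Y -> {set I}) :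
  {in YB, forall y, #|J y| <= w.*2} ->
  {in XA & YB, forall x y, T l x y -> hit ne (J y) x y} ->
  exists (K : Y -> {set I}) (EA : {set X}) (EB : {set Y}),
  [/\ 2 ^ w * #|EA| <= #|A| ^ #|I|, 2 ^ w * #|EB| <= #|B| ^ #|I|,
      {in ~: EB, forall y, #|K y| < w} &
      {in XA :\: EA & YB, forall x y, T l x y -> hit ne (K y) x y}].
Proof.
move=> hJ hT; have D0 : 0 < 16 * w ^ 2 by lia.
have [y /hJ Jy|K [hK1 hK2]] := triangle_step ne_sym D0 sparseA w _ hT.
  by have := leq_mul Jy Jy; rewrite mulnn; lia.
pose neT i b a j b' a' := ne i a b j a' b'.
have neT_sym i a b j a' b' : neT i a b j a' b' = neT j a' b' i a b by exact: ne_sym.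
have sparseB' i j b a a' : i != j -> 16 * w ^ 2 * #|[set b' | neT i b a j b' a']| <= #|B|.
  exact: sparseB.
pose EA := [set x | w <= #|K x|].
(* Exchanging and negating [f] and [g] gives the same triangle with the players swapped. Dropping
   the rows in [EA] keeps all certificates [K x] below [w]. *)
have [x||M [hM1 hM2]] := @triangle_step _ R I B A neT neT_sym _ D0 sparseB' w
   (fun y => - g l y)%R (fun x => - f l x)%R YB (XA :\: EA) K.
- rewrite !inE -ltnNge => /andP[Kx _].
  by have := leq_mul (ltnW Kx) (ltnW Kx); rewrite mulnn; lia.
- move=> y x yB; rewrite !inE => /andP[_ xA]; rewrite ltrN2 => Txy.
  by apply: (@hit_sub _ _ _ ne (K x :&: J y)); rewrite ?subsetIl //; apply: hK2.
exists M, EA, [set y | w <= #|M y|]; split => //.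
  by move=> y; rewrite !inE -ltnNge.
move=> x y xA yB Txy; apply: (@hit_sub _ _ _ ne (M y :&: K x)); rewrite ?subsetIl //.
by apply: (hM2 y x yB xA); rewrite ltrN2.
Qed.

Variable L : nat.
Hypothesis steps : forall l, l < L ->
  (exists J : {set I}, #|J| <= 2 /\ forall x y, T l x y -> hit ne J x y) \/
  (exists u v, [/\ u < l, v < l & forall x y, T l x y -> T u x y || T v x y]).

(** Each triangle adds at most a [2 ^ w]-th part of the rows and of the columns to the exceptional
    sets, while certificates return below [w] blocks before being used again. *)
Lemma dag_certificates n : n <= L ->
  exists (J : nat -> Y -> {set I}) (EA : {set X}) (EB : {set Y}),
  [/\ 2 ^ w * #|EA| <= n * #|A| ^ #|I|, 2 ^ w * #|EB| <= n * #|B| ^ #|I| &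
      forall l, l < n -> {in ~: EB, forall y, #|J l y| < w} /\
        {in ~: EA & ~: EB, forall x y, T l x y -> hit ne (J l y) x y}].
Proof.
elim: n => [_|n IH nL]; first by exists (fun _ _ => set0), set0, set0; rewrite !cards0 !muln0.
have [J [EA [EB [hA hB hJ]]]] := IH (ltnW nL).
have [M [FA [FB [hFA hFB hM1 hM2]]]] : exists (K : Y -> {set I}) (FA : {set X}) (FB : {set Y}),
  [/\ 2 ^ w * #|FA| <= #|A| ^ #|I|, 2 ^ w * #|FB| <= #|B| ^ #|I|,
      {in ~: FB, forall y, #|K y| < w} &
      {in ~: EA :\: FA & ~: EB, forall x y, T n x y -> hit ne (K y) x y}].
  have [[J0 [J02 hJ0]]|[u [v [un vn huv]]]] := steps nL.
    exists (fun _ => J0), set0, set0; rewrite !cards0 !muln0; split => //.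
      by move=> y _; exact: leq_ltn_trans J02 w_gt2.
    by move=> x y _ _; apply: hJ0.
  have [hu1 hu2] := hJ _ un; have [hv1 hv2] := hJ _ vn.
  apply: (@compress n (~: EA) (~: EB) (fun y => J u y :|: J v y)).
    move=> y yB; rewrite cardsU (leq_trans (leq_subr _ _)) //.
    by have := hu1 y yB; have := hv1 y yB; lia.
  move=> x y xA yB /huv /orP[] Txy.
    by apply: hit_sub (hu2 x y xA yB Txy); rewrite subsetUl.
  by apply: hit_sub (hv2 x y xA yB Txy); rewrite subsetUr.
exists (fun l => if l == n then M else J l), (EA :|: FA), (EB :|: FB).
have cU (Z : finType) (E F : {set Z}) c : 2 ^ w * #|E| <= n * c -> 2 ^ w * #|F| <= c ->
    2 ^ w * #|E :|: F| <= n.+1 * c.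
  move=> hE hF; rewrite mulSn addnC; apply: leq_trans (leq_add hE hF).
  by rewrite -mulnDr leq_mul2l leq_card_setU orbT.
split; [exact: cU|exact: cU|move=> l].
have sub y : y \in ~: (EB :|: FB) -> (y \in ~: EB) * (y \in ~: FB).
  by rewrite !inE negb_or => /andP[-> ->].
rewrite ltnS leq_eqVlt; have [->|_ /= ln] := eqVneq l n => /=.
  move=> _; split=> [y /sub[_]|x y]; first exact: hM1.
  rewrite setCU -setDE => xA /sub[yB _]; exact: hM2.
have [h1 h2] := hJ _ ln; split=> [y /sub[yB _]|x y]; first exact: h1.
rewrite setCU => /setIP[xA _] /sub[yB _]; exact: h2.
Qed.

(** Otherwise both exceptional sets have density below 1/2. A [y] outside [EB] then has a
    certificate at the full triangle that hits every [x] outside [EA], that is more than half of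
    them, against the quarter allowed by [hit_rare]. *)
Lemma dag_size : 0 < #|A| -> 0 < #|B| -> 0 < L -> (forall x y, T L.-1 x y) ->
  2 ^ w <= 2 * L.
Proof.
move=> A0 B0 L0 root; rewrite leqNgt; apply/negP => small.
have [J [EA [EB [hA hB hJ]]]] := dag_certificates (leqnn L).
have [h1 h2] : {in ~: EB, forall y, #|J L.-1 y| < w} /\
   {in ~: EA & ~: EB, forall x y, T L.-1 x y -> hit ne (J L.-1 y) x y} by apply: hJ; lia.
have XI : 0 < #|A| ^ #|I| by rewrite expn_gt0 A0.
have YI : 0 < #|B| ^ #|I| by rewrite expn_gt0 B0.
have [y yB] : exists y, y \in ~: EB.
  apply/set0Pn; rewrite -cards_eq0 -lt0n; have := cardsC EB; rewrite card_ffun.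
  by move: hB small; set a := 2 ^ w; nia.
have D0 : 0 < 16 * w ^ 2 by lia.
have hJ4 : 4 * #|J L.-1 y| ^ 2 <= 16 * w ^ 2.
  have Jy := h1 y yB; by have := leq_mul (ltnW Jy) (ltnW Jy); rewrite mulnn; lia.
have rare := hit_rare y D0 sparseA hJ4.
have : #|A| ^ #|I| <= #|EA| + #|[set x : X | hit ne (J L.-1 y) x y]|.
  rewrite -card_ffun -cardsT.
  apply: leq_trans (leq_card_setU _ _); apply/subset_leq_card/subsetP => x _.
  rewrite !inE; have [//|xA /=] := boolP (x \in EA).
  by apply: (h2 x y _ yB (root x y)); rewrite inE.
move: hA small rare; set a := 2 ^ w; set c := #|_| ^ _ in XI *; nia.
Qed.

End Dag.

(** * From refutations to triangle dags *)

Lemma eq_bits m v v' : v < 2 ^ m -> v' < 2 ^ m ->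
  (forall e, e < m -> odd (v %/ 2 ^ e) = odd (v' %/ 2 ^ e)) -> v = v'.
Proof.
elim: m v v' => [|m IH] v v'; first by case: v v' => [|v] [|v'].
rewrite expnS => hv hv' h.
rewrite -(odd_double_half v) -(odd_double_half v').
have := h 0 isT; rewrite !divn1 => ->; congr (_ + _.*2).
apply: IH => [||e em]; rewrite -?divn2 ?ltn_divLR // 1?[_ * 2]mulnC //.
by have := h e.+1 em; rewrite expnS !divnMA.
Qed.

Lemma odd_div_high a b mB e : b < 2 ^ mB -> mB <= e ->
  odd ((a * 2 ^ mB + b) %/ 2 ^ e) = odd (a %/ 2 ^ (e - mB)).
Proof.
move=> bB Be; rewrite -{1}(subnKC Be) expnD divnMA divnMDl ?expn_gt0 //.
by rewrite (divn_small bB) addn0.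
Qed.

Lemma odd_div_low a b mB e : e < mB ->
  odd ((a * 2 ^ mB + b) %/ 2 ^ e) = odd (b %/ 2 ^ e).
Proof.
move=> eB; rewrite -{1}(subnK (ltnW eB)) expnD mulnA divnMDl ?expn_gt0 //.
by rewrite oddD oddM oddX subn_eq0 leqNgt eB andbF.
Qed.

(** With the constant moved to the left, the inequality says that the number of true literals,
    counted with multiplicity, is at least 1. *)
Lemma falsified_clause (R : realType) (X : finType) (c : clause X) (x : {ffun X -> bool}) :
  ~~ holds01 (clause_ineq R c) x -> {in c, forall l, x l.1 = ~~ l.2}.
Proof.
pose lit (l : literal X) := x l.1 == l.2.
have E : (\sum_y (clause_ineq R c).1 y * (x y)%:R + (count (fun l => ~~ l.2) c)%:R =
          (count lit c)%:R :> R)%R.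
  rewrite -!sum1_count !natr_sum.
  have -> : (\sum_y (clause_ineq R c).1 y * (x y)%:R =
     \sum_(l <- c) (if l.2 then 1 else -1) * (x l.1)%:R :> R)%R.
    rewrite [RHS](partition_big (fun l => l.1) predT) //=; apply: eq_bigr => y _.
    by rewrite ffunE mulr_suml; apply: eq_bigr => l /eqP->.
  rewrite [X in (_ + X)%R]big_mkcond [RHS]big_mkcond -big_split /=.
  apply: eq_bigr => -[y b] _; rewrite /lit /=.
  by case: b; case: (x y); rewrite /= ?mulr1 ?mulr0 ?addr0 ?add0r ?addNr.
rewrite /holds01 [(_).2]/= lerBlDr E -ltNge ltrn1 => h l lc.
apply/eqP; case: (boolP (lit l)) => [ll|]; last by rewrite /lit; case: (x _) l.2 => [] [].
have : has lit c by apply/hasP; exists l.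
by rewrite has_count ltnNge -ltnS h.
Qed.

Section Encoding.

Variables (R : realType) (m mA mB k : nat).
Hypothesis mAB : mA + mB = m.

Lemma join_subproof (a : 'I_(2 ^ mA)) (b : 'I_(2 ^ mB)) : a * 2 ^ mB + b < 2 ^ m.
Proof.
rewrite -mAB expnD; have := ltn_ord a; have := ltn_ord b.
move: (2 ^ mA) (2 ^ mB) (a : nat) (b : nat) => u v a' b' hb ha.
by apply: (@leq_trans (a'.+1 * v)); [rewrite mulSn addnC ltn_add2r|rewrite leq_mul2r ha orbT].
Qed.

Definition join (a : 'I_(2 ^ mA)) (b : 'I_(2 ^ mB)) : 'I_(2 ^ m) :=
  Ordinal (join_subproof a b).

Lemma join_inj a b a' b' : join a b = join a' b' -> a = a' /\ b = b'.
Proof.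
move=> /(congr1 val) /= h; have p0 : 0 < 2 ^ mB by rewrite expn_gt0.
split; apply/val_inj => /=.
  have := congr1 (divn^~ (2 ^ mB)) h.
  by rewrite !divnMDl // !divn_small ?addn0 ?ltn_ord.
have := congr1 (modn^~ (2 ^ mB)) h.
by rewrite !modnMDl !modn_small ?ltn_ord.
Qed.

Variable G : {set {set vert m k}}.

Definition nonedge (i : 'I_k) a b (j : 'I_k) a' b' : bool :=
  [set (i, join a b); (j, join a' b')] \notin G.

Lemma nonedge_sym i a b j a' b' : nonedge i a b j a' b' = nonedge j a' b' i a b.
Proof. by rewrite /nonedge setUC. Qed.

Local Notation X := {ffun 'I_k -> 'I_(2 ^ mA)}.
Local Notation Y := {ffun 'I_k -> 'I_(2 ^ mB)}.

Definition assignment (x : X) (y : Y) : {ffun var m k -> bool} :=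
  [ffun v => vbit (join (x v.1) (y v.1)) v.2].

(** Bits are numbered from the most significant one, so bit [v.2] has place value
    [2 ^ (m.-1 - v.2)]; Alice owns the places from [2 ^ mB] up. *)
Definition high (v : var m k) : bool := mB <= m.-1 - v.2.

Definition high_part (l : ineq R (var m k)) (x : X) : R :=
  (\sum_(v | high v) l.1 v * (odd (x v.1 %/ 2 ^ (m.-1 - v.2 - mB)))%:R)%R.

Definition low_part (l : ineq R (var m k)) (y : Y) : R :=
  (l.2 - \sum_(v | ~~ high v) l.1 v * (odd (y v.1 %/ 2 ^ (m.-1 - v.2)))%:R)%R.

(** The linear form is a sum over variables, and each variable depends on the half of one player
    only. *)
Lemma falsified_triangle l x y :
  ~~ holds01 l (assignment x y) = (high_part l x < low_part l y)%R.
Proof.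
rewrite /holds01 -ltNge /low_part ltrBrDr (bigID high) /=.
congr (_ + _ < _)%R; apply: eq_bigr => v hv; rewrite ffunE /vbit /=; congr (_ * _%:R)%R.
  by rewrite odd_div_high.
by rewrite odd_div_low // ltnNge.
Qed.

Lemma falsified_bc_clause i j vi vj x :
  ~~ holds01 (clause_ineq R (@bc_clause m k i j vi vj)) x ->
  forall a, x (i, a) = vbit vi a /\ x (j, a) = vbit vj a.
Proof.
move=> /falsified_clause h a; split.
  rewrite (h ((i, a), ~~ vbit vi a)) /= ?negbK // mem_cat; apply/orP; left.
  by apply/mapP; exists a; rewrite ?mem_enum.
rewrite (h ((j, a), ~~ vbit vj a)) /= ?negbK // mem_cat; apply/orP; right.
by apply/mapP; exists a; rewrite ?mem_enum.
Qed.

Lemma vbit_inj (v v' : 'I_(2 ^ m)) : (forall a : 'I_m, vbit v a = vbit v' a) -> v = v'.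
Proof.
move=> h; apply/val_inj/(@eq_bits m); rewrite ?ltn_ord // => e em.
have em' : m.-1 - e < m by lia.
by have := h (Ordinal em'); rewrite /vbit /= (_ : m.-1 - (m.-1 - e) = e) //; lia.
Qed.

Lemma holds_lower (v : var m k) x : holds01 (lower_ineq R v) x.
Proof.
by rewrite /holds01 /=; apply: sumr_ge0 => y _; rewrite ffunE mulr_ge0 ?ler0n.
Qed.

Lemma holds_upper (v : var m k) x : holds01 (upper_ineq R v) x.
Proof.
rewrite /holds01 /= (bigD1 v) //= big1 => [|y /negbTE yv]; last by rewrite ffunE yv oppr0 mul0r.
by rewrite ffunE eqxx addr0 mulN1r lerN2; case: (x v).
Qed.

Lemma axiom_hit (l : ineq R (var m k)) : @BinClique_system R m k G l ->
  exists J : {set 'I_k}, #|J| <= 2 /\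
    forall x y, (high_part l x < low_part l y)%R -> hit nonedge J x y.
Proof.
case=> [[v ->]|[[v ->]|[c [[i [j [vi [vj [ij [nG ->]]]]]] ->]]]].
- by exists set0; rewrite cards0; split=> // x y; rewrite -falsified_triangle holds_lower.
- by exists set0; rewrite cards0; split=> // x y; rewrite -falsified_triangle holds_upper.
exists [set i; j]; rewrite cards2 ij; split=> // x y.
rewrite -falsified_triangle => /falsified_bc_clause h.
have hi : join (x i) (y i) = vi by apply: vbit_inj => a; have [<- _] := h a; rewrite ffunE.
have hj : join (x j) (y j) = vj by apply: vbit_inj => a; have [_ <-] := h a; rewrite ffunE.
apply/existsP; exists (i, j); rewrite !inE !eqxx orbT /= /conflict /= ij.
by rewrite /nonedge hi hj.
Qed.

(** An inference read contrapositively is the covering of a triangle by two earlier ones; the final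
    inequality fails everywhere, so its triangle is full. *)
Lemma refutation_size w (s : seq (ineq R (var m k))) : 2 < w ->
  (forall i j a b b', i != j ->
    16 * w ^ 2 * #|[set a' | nonedge i a b j a' b']| <= 2 ^ mA) ->
  (forall i j a b a', i != j ->
    16 * w ^ 2 * #|[set b' | nonedge i a b j a' b']| <= 2 ^ mB) ->
  semCP_refutation (@BinClique_system R m k G) s -> 2 ^ w <= 2 * size s.
Proof.
move=> w2 sA sB [s0 [lasts steps]].
pose d0 := false_ineq R (var m k).
apply: (@dag_size _ _ _ nonedge nonedge_sym w w2 _ _ R
   (fun l => high_part (nth d0 s l)) (fun l => low_part (nth d0 s l)) (size s)).
- by move=> i j a b b' ij; rewrite card_ord; apply: sA.
- by move=> i j a b b' ij; rewrite card_ord; apply: sB.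
- move=> l /steps[/axiom_hit|[u [v [ul vl imp]]]]; first by left.
  right; exists u, v; split=> // x y; rewrite -!falsified_triangle.
  by rewrite -negb_and; apply: contraNN => /andP[]; apply: imp.
- by rewrite card_ord expn_gt0.
- by rewrite card_ord expn_gt0.
- by [].
move=> x y; rewrite nth_last lasts -falsified_triangle /holds01 /= big1 ?ler10 //.
by move=> v _; rewrite ffunE mul0r.
Qed.

End Encoding.

(** A single line would have to be an axiom false at every 0-1 point. Bound constraints are always
    true, and a clause cannot be falsified by both constant assignments, as they differ on its first
    variable. *)
Lemma refutation_size_gt1 (R : realType) (m k : nat) (G : {set {set vert m k}})
    (s : seq (ineq R (var m k))) : 0 < m ->
  semCP_refutation (@BinClique_system R m k G) s -> 1 < size s.
Proof.
case: m G s => // m G s _ [s0 [lasts /(_ 0 s0)]].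
rewrite ltnNge; case=> [|[u [v []]]] //; apply: contraPN => s1.
have -> : nth (false_ineq R (var m.+1 k)) s 0 = false_ineq R (var m.+1 k).
  by rewrite -[in RHS]lasts -nth_last; case: (size s) s1 s0 => [|[]].
have F x : holds01 (false_ineq R (var m.+1 k)) x = false.
  by rewrite /holds01 /= big1 ?ler10 // => v _; rewrite ffunE mul0r.
case=> [[v e]|[[v e]|[c [[i [j [vi [vj [ij [nG ->]]]]]] e]]]].
- by have := F [ffun => false]; rewrite e holds_lower.
- by have := F [ffun => false]; rewrite e holds_upper.
have falsified x : ~~ holds01 (clause_ineq R (@bc_clause m.+1 k i j vi vj)) x by rewrite -e F.
have [h1 _] := falsified_bc_clause (falsified [ffun => true]) ord0.
have [h2 _] := falsified_bc_clause (falsified [ffun => false]) ord0.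
by move: h1; rewrite -h2 !ffunE.
Qed.

Local Open Scope ring_scope.

(** * Non-edges of random block graphs *)

Section RandomGraph.

Variables (R : realType) (m k : nat) (p : R).
Hypothesis p01 : 0 <= p <= 1.

Local Notation graph := {set {set vert m k}}.
Local Notation C := (cross_pairs m k).

Definition graph_weight (G : graph) : R := p ^+ #|G| * (1 - p) ^+ (#|C| - #|G|).

Lemma graph_weight_ge0 G : 0 <= graph_weight G.
Proof. by case/andP: p01 => p0 p1; rewrite mulr_ge0 // exprn_ge0 // subr_ge0. Qed.

(** The generating function at 2 of the number of missing edges: by independence it is a product, to
    which each pair of [S] contributes [p + 2 * (1 - p)]. *)
Lemma missing_edges_mgf (S : {set {set vert m k}}) : S \subset C ->
  \sum_(G : graph | is_graph G) graph_weight G * 2 ^+ #|S :\: G| = (2 - p) ^+ #|S|.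
Proof.
move=> SC.
(* The value 0 outside the cross pairs removes the sets that are not graphs from the expanded
   product. *)
pose a (e : {set vert m k}) : R := if e \in C then p else 0.
pose b (e : {set vert m k}) : R :=
  (if e \in C then 1 - p else 1) * (if e \in S then 2 else 1).
have -> : (2 - p) ^+ #|S| = \prod_e (a e + b e).
  rewrite (bigID (mem S)) /= [X in _ * X]big1 ?mulr1.
    rewrite -prodr_const; apply: eq_bigr => e eS.
    by rewrite /a /b eS (subsetP SC) //; ring.
  by move=> e eS; rewrite /a /b (negbTE eS); case: ifP => _; ring.
rewrite bigA_distr big_mkcond /=; apply: eq_bigr => G _.
rewrite /is_graph; case: ifP => [GC|/negbT/subsetPn[e eG eC]]; last first.
  by rewrite (bigD1 e) //= eG /a (negbTE eC) mul0r.
rewrite (bigID (mem G)) /= -mulrA; congr (_ * _).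
  by rewrite -prodr_const; apply: eq_bigr => e eG; rewrite eG /a (subsetP GC).
rewrite (eq_bigr b) => [|e /negbTE -> //]; rewrite big_split /=; congr (_ * _).
  rewrite -big_mkcondr /= prodr_const; congr (_ ^+ _).
  rewrite -(cardsDS GC); apply: eq_card => e.
  exact: in_setD.
rewrite -big_mkcondr /= prodr_const; congr (_ ^+ _).
by apply: eq_card => e; rewrite !inE.
Qed.

Lemma Pr_setC (E : {set graph}) : Pr_G p (~: E) = 1 - Pr_G p E.
Proof.
have Pr_weight (F : {set graph}) :
    Pr_G p F = \sum_(G | is_graph G && (G \in F)) graph_weight G.
  by apply: eq_bigl => G; rewrite andbC.
have total : \sum_(G : graph | is_graph G) graph_weight G = 1.
  have := missing_edges_mgf (sub0set _); rewrite cards0 expr0 => <-.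
  by apply: eq_bigr => G _; rewrite set0D cards0 expr0 mulr1.
rewrite -total (bigID (mem E)) /= !Pr_weight addrAC subrr add0r.
by apply: eq_bigl => G; rewrite inE.
Qed.

Lemma Pr_subset (E F : {set graph}) : E \subset F -> Pr_G p E <= Pr_G p F.
Proof.
move=> EF; rewrite /Pr_G [leRHS](bigID (mem E)) /= -[leLHS]addr0 lerD //.
  rewrite le_eqVlt; apply/orP; left; apply/eqP/eq_bigl => G.
  by case: (boolP (G \in E)) => [/(subsetP EF) ->|]; rewrite ?andbT ?andbF.
by apply: sumr_ge0 => G _; apply: graph_weight_ge0.
Qed.

Lemma Pr_bigcup (J : finType) (P : pred J) (F : J -> {set graph}) :
  Pr_G p (\bigcup_(j | P j) F j) <= \sum_(j | P j) Pr_G p (F j).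
Proof.
elim/big_rec2: _ => [|j x E _ IH]; first by rewrite /Pr_G big1 // => G; rewrite inE.
apply: le_trans (lerD (lexx _) IH).
rewrite /Pr_G (bigID (mem (F j))) /= lerD //.
  rewrite le_eqVlt; apply/orP; left; apply/eqP/eq_bigl => G.
  by rewrite inE; case: (G \in F j); rewrite ?andbT ?andbF.
rewrite [leRHS](bigID (mem (F j))) /= -[leLHS]add0r lerD //.
  by apply: sumr_ge0 => G _; apply: graph_weight_ge0.
rewrite le_eqVlt; apply/orP; left; apply/eqP/eq_bigl => G.
by rewrite inE; case: (G \in F j); rewrite ?andbT ?andbF.
Qed.

Lemma expR_half_le2 : expR (2^-1) <= 2 :> R.
Proof.
have h := @expR_ge1Dx R (- 2^-1).
have := expRxMexpNx_1 (2^-1 : R); have := expR_gt0 (2^-1 : R).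
move: h; set u := expR (- _); set v := expR _; nra.
Qed.

Lemma expR_half_le2X n : expR (n%:R / 2) <= 2 ^+ n :> R.
Proof. by rewrite expRM_natl lerXn2r ?nnegrE ?expR_ge0 ?expR_half_le2. Qed.

(* The last hypothesis says that [N / D] is at least four times the mean. *)
Lemma missing_edges_tail (S : {set {set vert m k}}) (N D : nat) :
  S \subset C -> #|S| = N -> (0 < D)%N -> (1 - p) * (4 * D%:R) <= 1 ->
  Pr_G p [set G : graph | (N < D * #|S :\: G|)%N] <= expR (- (N%:R / (4 * D%:R))).
Proof.
move=> SC SN D0 qD.
have D0R : 0 < D%:R :> R by rewrite ltr0n.
(* The mean is at most [t] and the event asks for more than [4 * t] missing edges. Hence
   [2 ^+ #|S :\: G|] is at least [expR (t * 2)] on the event but has mean at most [expR t], and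
   Markov's inequality leaves [expR (- t)]. *)
pose t : R := N%:R / (4 * D%:R).
have mk G : (N < D * #|S :\: G|)%N -> expR (t * 2) <= 2 ^+ #|S :\: G|.
  move=> h; apply: le_trans (expR_half_le2X _); rewrite ler_expR.
  have -> : t * 2 = N%:R / D%:R / 2 by rewrite /t; field; rewrite gt_eqF.
  rewrite ler_pM2r ?invr_gt0 ?ltr0n // ler_pdivrMr // -natrM ler_nat mulnC.
  exact: ltnW.
have mgf : (2 - p) ^+ #|S| <= expR t.
  rewrite SN /t; have qle : 1 - p <= (4 * D%:R)^-1.
    by rewrite -[leRHS]mul1r ler_pdivlMr // mulr_gt0.
  rewrite expRM_natl lerXn2r ?nnegrE ?expR_ge0 //; first by have/andP[] := p01; lra.
  by apply: le_trans (expR_ge1Dx _); lra.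
have : Pr_G p [set G : graph | (N < D * #|S :\: G|)%N] * expR (t * 2) <= expR t.
  apply: le_trans mgf; rewrite -missing_edges_mgf // /Pr_G mulr_suml.
  rewrite [leRHS](bigID [pred G | (N < D * #|S :\: G|)%N]) /= -[leLHS]addr0 lerD //.
    rewrite [leRHS](eq_bigl (fun G =>
        (G \in [set G : graph | (N < D * #|S :\: G|)%N]) && is_graph G)).
      apply: ler_sum => G; rewrite inE => /andP[h _].
      by apply: ler_wpM2l (mk _ h); apply: graph_weight_ge0.
    by move=> G; rewrite inE andbC.
  by apply: sumr_ge0 => G _; rewrite mulr_ge0 ?graph_weight_ge0 // exprn_ge0.
have -> : expR t = expR (- t) * expR (t * 2) by rewrite -expRD; congr expR; ring.
by rewrite ler_pM2r ?expR_gt0.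
Qed.

End RandomGraph.

Lemma star_tail (R : realType) (m k : nat) (p : R) (Z : finType) (h : Z -> 'I_(2 ^ m))
    (u : vert m k) (j : 'I_k) (D : nat) :
  0 <= p <= 1 -> injective h -> u.1 != j -> (0 < D)%N -> (1 - p) * (4 * D%:R) <= 1 ->
  Pr_G p [set G : {set {set vert m k}} |
    (#|Z| < D * #|[set z | [set u; (j, h z)] \notin G]|)%N]
    <= expR (- (#|Z|%:R / (4 * D%:R))).
Proof.
move=> p01 hI uj D0 qD; pose e z := [set u; (j, h z)].
have eI : injective e.
  move=> z z' /setP /(_ (j, h z)); rewrite !inE eqxx orbT => /esym/orP[/eqP zu|/eqP[/hI //]].
  by move: uj; rewrite -zu eqxx.
have SC : e @: setT \subset cross_pairs m k.
  apply/subsetP => _ /imsetP[z _ ->]; rewrite inE; apply/existsP; exists u.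
  by apply/existsP; exists (j, h z); rewrite uj eqxx.
have Sc : #|e @: setT| = #|Z| by rewrite card_imset // cardsT.
apply: le_trans (missing_edges_tail p01 SC Sc D0 qD).
apply: Pr_subset => //; apply/subsetP => G; rewrite !inE => lt.
apply: leq_trans lt _; rewrite leq_mul2l; apply/orP; right.
rewrite -(card_imset _ eI); apply/subset_leq_card/subsetP => _ /imsetP[z + ->].
by rewrite !inE => ->; rewrite imset_f.
Qed.

Definition long_refutations (R : realType) (m k w : nat) : {set {set {set vert m k}}} :=
  [set G | `[< forall s : seq (ineq R (var m k)),
     semCP_refutation (@BinClique_system R m k G) s -> (2 ^ w <= 2 * size s)%N >]].

(** Union bound over the stars from a vertex to the vertices of another block with one half
    prescribed. The smaller half, of size [2 ^ m./2], gives the weaker tail. *)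
Lemma long_refutations_likely (R : realType) (m k w : nat) (p : R) :
  0 <= p <= 1 -> (2 < w)%N -> (1 - p) * (64 * (w%:R ^+ 2)) <= 1 ->
  1 - Pr_G p (long_refutations R m k w) <=
    2 * ((k * 2 ^ m)%:R ^+ 2) * expR (- ((2 ^ m./2)%:R / (64 * w%:R ^+ 2))).
Proof.
move=> p01 w2 qw.
pose mB := m./2; pose mA := (m - mB)%N.
have mAB : (mA + mB = m)%N by rewrite /mA /mB; lia.
have BA : (mB <= mA)%N by rewrite /mA /mB; lia.
pose D := (16 * w ^ 2)%N.
have D0 : (0 < D)%N by rewrite /D; lia.
have D4 : 4 * D%:R = 64 * w%:R ^+ 2 :> R by rewrite /D natrM natrX; ring.
have qD : (1 - p) * (4 * D%:R) <= 1 by rewrite D4.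
pose IA := ('I_k * 'I_k * 'I_(2 ^ mA) * 'I_(2 ^ mB) * 'I_(2 ^ mB))%type.
pose IB := ('I_k * 'I_k * 'I_(2 ^ mA) * 'I_(2 ^ mB) * 'I_(2 ^ mA))%type.
pose badA (t : IA) : {set {set {set vert m k}}} := let: (i, j, a, b, b') := t in
  [set G | (2 ^ mA < D * #|[set a' | nonedge mAB G i a b j a' b']|)%N].
pose badB (t : IB) : {set {set {set vert m k}}} := let: (i, j, a, b, a') := t in
  [set G | (2 ^ mB < D * #|[set b' | nonedge mAB G i a b j a' b']|)%N].
pose bad (t : IA + IB) := match t with inl t => badA t | inr t => badB t end.
pose ok (t : IA + IB) := match t with
  | inl (i, j, _, _, _) => i != j | inr (i, j, _, _, _) => i != j end.
pose r : R := expR (- ((2 ^ mB)%:R / (64 * w%:R ^+ 2))).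
have w0 : 0 < 64 * w%:R ^+ 2 :> R by rewrite mulr_gt0 // exprn_gt0 // ltr0n; lia.
have rmono n : (2 ^ mB <= n)%N -> expR (- (n%:R / (4 * D%:R))) <= r.
  by move=> h; rewrite ler_expR lerN2 D4 ler_pM2r ?invr_gt0 // ler_nat.
have badr t : ok t -> Pr_G p (bad t) <= r.
  case: t => [[[[[i j] a] b] b']|[[[[i j] a] b] a']] /= ij.
    have hI : injective (fun a' => join mAB a' b') by move=> x y /join_inj[].
    have := @star_tail R m k p _ _ (i, join mAB a b) j D p01 hI ij D0 qD.
    rewrite card_ord => h; apply: le_trans h (rmono _ _).
    by rewrite leq_exp2l.
  have hI : injective (fun b' => join mAB a' b') by move=> x y /join_inj[].
  have := @star_tail R m k p _ _ (i, join mAB a b) j D p01 hI ij D0 qD.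
  by rewrite card_ord => h; apply: le_trans h (rmono _ _).
have cov : ~: long_refutations R m k w \subset \bigcup_(t | ok t) bad t.
  apply/subsetP => G; rewrite !inE; apply: contraNT => /bigcupP nb; apply/asboolP => s.
  apply: (refutation_size (mAB := mAB)) => // [i j a b b'|i j a b a'] ij.
    rewrite leqNgt; apply/negP => h; apply: nb.
    by exists (inl (i, j, a, b, b')); rewrite //= inE.
  rewrite leqNgt; apply/negP => h; apply: nb.
  by exists (inr (i, j, a, b, a')); rewrite //= inE.
rewrite -Pr_setC //; apply: le_trans (Pr_subset p01 cov) _.
apply: le_trans (Pr_bigcup p01 _ _) _.
apply: (@le_trans _ _ (\sum_(t | ok t) r)); first exact: ler_sum.
rewrite sumr_const -[_ *+ _]mulr_natl -[expR _]/r ler_pM2r ?expR_gt0 //.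
rewrite -natrX -natrM ler_nat; apply: leq_trans (max_card _) _.
rewrite card_sum !card_prod !card_ord -mAB expnD.
have AA : (2 ^ mB <= 2 ^ mA)%N by rewrite leq_exp2l.
have B1 : (0 < 2 ^ mB)%N by rewrite expn_gt0.
have A1 : (0 < 2 ^ mA)%N by rewrite expn_gt0.
set a := (2 ^ mA)%N in AA A1 *; set b := (2 ^ mB)%N in AA B1 *.
(* Each of the two families of stars has at most the square of [k * 2 ^ m] members. *)
rewrite (_ : 2 * (k * (a * b)) ^ 2 =
    k * k * a * b * (a * b) + k * k * a * b * (a * b))%N; last by ring.
by rewrite leq_add // leq_mul2l ?leq_pmull ?leq_pmulr ?orbT.
Qed.

(** * ** Choice of the width and the final bound *)

Lemma ln_ge_half (R : realType) (m k : nat) : (0 < k)%N ->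
  m%:R / 2 <= ln (k * 2 ^ m)%:R :> R.
Proof.
move=> k0; have n0 : 0 < (k * 2 ^ m)%:R :> R by rewrite ltr0n muln_gt0 k0 expn_gt0.
rewrite -ler_expR lnK ?posrE //; apply: le_trans (expR_half_le2X _ _) _.
by rewrite -natrX ler_nat leq_pmull.
Qed.

Lemma cp_rate_sqr (R : realType) (m k : nat) (p : R) : 0 <= p <= 1 ->
  0 < cp_rate m k p ->
  [/\ (0 < k)%N, (1 - p) * cp_rate m k p ^+ 2 <= 1 &
      cp_rate m k p ^+ 2 * ln (k * 2 ^ m)%:R ^+ 2 <= 2 * (2 ^ m./2)%:R].
Proof.
move=> /andP[p0 p1] r0; set r := cp_rate m k p in r0 *.
set y := ln (k * 2 ^ m)%:R; set q := Num.sqrt (1 - p).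
have rq : r <= 1 / q by rewrite ge_min lexx.
have ry : r <= Num.sqrt (Num.sqrt (2 ^ m)%:R) / y by rewrite ge_min lexx orbT.
have q0 : 0 < q.
  (* Division by zero yields 0, so [p = 1] would make the rate nonpositive. *)
  rewrite lt_def sqrtr_ge0 andbT; apply: contraTneq r0 => qE.
  by rewrite -leNgt (le_trans rq) // qE invr0 mulr0.
have y0 : 0 < y.
  rewrite ltNge; apply: contraTN r0 => yle; rewrite -leNgt (le_trans ry) //.
  by rewrite mulr_ge0_le0 ?sqrtr_ge0 ?invr_le0.
split.
- by case: (posnP k) y0 => // k0; rewrite /y k0 mul0n ln0 // ltxx.
- have qr : q * r <= 1 by rewrite mulrC -ler_pdivlMr.
  rewrite -(@sqr_sqrtr _ (1 - p)) ?subr_ge0 // -/q -exprMn exprn_ile1 //.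
  by rewrite mulr_ge0 ?ltW.
move: ry; rewrite ler_pdivlMr // => ry.
have h1 : (r * y) ^+ 2 <= Num.sqrt (2 ^ m)%:R.
  rewrite -[leRHS]sqr_sqrtr ?sqrtr_ge0 // lerXn2r ?nnegrE ?sqrtr_ge0 //.
  by rewrite mulr_ge0 ?ltW.
(* Rounding [m / 2] down loses at most a factor [sqrt 2], covered by the 2 in the claim. *)
rewrite -exprMn; apply: le_trans h1 _; rewrite -natrM.
rewrite -[leRHS]ger0_norm ?ler0n // -sqrtr_sqr ler_wsqrtr // -natrX ler_nat.
by rewrite -expnS -expnM leq_exp2l //; lia.
Qed.

(** Here [y] will be [ln (k * 2 ^ m)]. As [y] is at least 3, the exponent [2 * y - 2 * y ^+ 2] is at
    most [- y], and [expR y] exceeds [2 / eps]. *)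
Lemma union_bound_small (R : realType) (y eps : R) : 0 < eps -> 3 + 2 / eps <= y ->
  2 * expR y ^+ 2 * expR (- (2 * y ^+ 2)) <= eps.
Proof.
move=> e0 hy; have d0 : 0 < 2 / eps by rewrite divr_gt0.
rewrite -expRM_natr -mulrA -expRD.
apply: (@le_trans _ _ (2 * expR (- y))); first by rewrite ler_pM2l // ler_expR; nra.
rewrite -ler_pdivlMl // -lef_pV2 ?posrE ?expR_gt0 ?mulr_gt0 ?invr_gt0 //.
rewrite expRN invrK invfM invrK; apply: le_trans (expR_ge1Dx y); lra.
Qed.

Theorem theorem4p1 (R : realType) :
  exists c : R, 0 < c /\
  forall (k : nat -> nat) (p : nat -> R),
    (forall m, 0 <= p m <= 1) ->
    forall eps : R, 0 < eps ->
    exists M : nat, forall m : nat, (M <= m)%N ->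
      1 - eps <=
      Pr_G (p m)
        [set G : {set {set vert m (k m)}} |
           `[< forall s : seq (ineq R (var m (k m))),
                 semCP_refutation (@BinClique_system R m (k m) G) s ->
                 expR (c * cp_rate m (k m) (p m)) <= (size s)%:R >]].
Proof.
(* For rates below 64 the exponent stays below 1/2, where length 2 suffices. *)
exists (1 / 128); split; first by rewrite divr_gt0.
(* The threshold makes [m / 2], hence [ln (k * 2 ^ m)], at least [3 + 2 / eps]. *)
move=> k p p01 eps e0; exists (Num.bound (6 + 4 / eps)) => m Mm.
have d0 : 0 < 4 / eps by rewrite divr_gt0.
have hm : 6 + 4 / eps <= m%:R.
  apply: ltW; apply: lt_le_trans (archi_boundP _) _; first by lra.
  by rewrite ler_nat.
have m0 : (0 < m)%N by rewrite -(ltr0n R); lra.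
set E := [set G | _]; set r := cp_rate m (k m) (p m) in E *.
have [r64|r64] := ltP r 64.
  have -> : E = ~: set0.
    apply/setP => G; rewrite !inE; apply/asboolP => s /(refutation_size_gt1 m0) s2.
    apply: (@le_trans _ _ 2); last by rewrite ler_nat.
    by apply: le_trans (expR_half_le2 _); rewrite ler_expR; lra.
  rewrite Pr_setC // /Pr_G big1 => [|G]; last by rewrite inE.
  by rewrite lerD2l lerN2 ltW.
have [|k0 rp ry] := @cp_rate_sqr R m (k m) (p m) (p01 m); first by rewrite -/r; lra.
rewrite -/r in rp ry; set y := ln _ in ry.
have my : m%:R / 2 <= y by exact: ln_ge_half.
(* The divisor 16 gives [256 * w ^+ 2 <= r ^+ 2], so that [cp_rate_sqr] yields the sparsity
   condition and a tail exponent of at least [2 * y ^+ 2]. *)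
pose w := Num.truncn (r / 16).
have /andP[wr rw] : w%:R <= r / 16 < w.+1%:R by apply: Num.Theory.truncn_itv; lra.
have w2 : (2 < w)%N by rewrite -ltnS -(ltr_nat R); lra.
have w0 : 0 < w%:R :> R by rewrite ltr0n (ltnW (ltnW w2)).
have w2r : 256 * w%:R ^+ 2 <= r ^+ 2 by nra.
have [p0 p1] := andP (p01 m).
have qw : (1 - p m) * (64 * (w%:R ^+ 2)) <= 1.
  by apply: le_trans rp; rewrite ler_wpM2l ?subr_ge0 //; nra.
have likely := @long_refutations_likely R m (k m) w (p m) (p01 m) w2 qw.
have sub : long_refutations R m (k m) w \subset E.
  apply/subsetP => G; rewrite !inE => /asboolP h; apply/asboolP => s /h hs.
  have : (2 ^ w.-1 <= size s)%N by move: hs; rewrite -{1}(prednK (ltnW (ltnW w2))) expnS leq_mul2l.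
  rewrite -(ler_nat R) natrX; apply: le_trans.
  (* The exponent [w.-1 / 2] exceeds [r / 32 - 1], which is at least [r / 128] once [r] is at least
     64. *)
  apply: le_trans (expR_half_le2X _ _); rewrite ler_expR.
  have w1 : w%:R = w.-1%:R + 1 :> R by rewrite natr1 (prednK (ltnW (ltnW w2))).
  have : r / 16 < w%:R + 1 by rewrite natr1.
  by move: r64 w1; clear; lra.
apply: le_trans (Pr_subset (p01 m) sub); rewrite lerBlDr addrC -lerBlDr.
apply: le_trans likely _.
have n0 : 0 < (k m * 2 ^ m)%:R :> R by rewrite ltr0n muln_gt0 k0 expn_gt0.
rewrite -[(k m * 2 ^ m)%:R]lnK ?posrE // -/y.
apply: (le_trans _ (@union_bound_small R y eps e0 _)); last by lra.
rewrite ler_pM2l ?mulr_gt0 ?exprn_gt0 ?expR_gt0 // ler_expR lerN2.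
rewrite ler_pdivlMr ?mulr_gt0 ?exprn_gt0 //.
have : y ^+ 2 * (256 * w%:R ^+ 2) <= y ^+ 2 * r ^+ 2 by rewrite ler_wpM2l ?sqr_ge0.
by move: ry; rewrite mulrC; clear; lra.
Qed.
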